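(* Let $(A_n)_{n\in\mathbb{N}}$ and $(B_n)_{n\in\mathbb{N}}$ be sequences of scalars with $\lim_{n\to\infty} A_n=\lim_{n\to\infty} B_n=1$ such that for every $n\in\mathbb{N}$ and every finite dimensional Hilbert space $K$, every tight frame of $K$ consisting of vectors of norm at most $1/n$ and having frame bound greater than $1$ has a subset which is a frame of $K$ with lower frame bound $A_n$ and upper frame bound $B_n$. Let $N\in\mathbb{N}$. If $(x_i)_{i\in I}$ is a scalable frame in a finite dimensional Hilbert space $H$, then there exist scalars $(c_i)_{i\in I}\subseteq\{\sqrt{m}/N:m\in\mathbb{Z}\}$ such that $(c_ix_i)_{i\in I}$ is a frame of $H$ with lower frame bound $A_N$ and upper frame bound $B_N$.
   Context: A collection $(x_i)_{i\in I}$ of vectors in a Hilbert space $H$ is a frame of $H$ with lower frame bound $a>0$ and upper frame bound $b>0$ if $a\|x\|^2\le\sum_{i\in I}|\langle x,x_i\rangle|^2\le b\|x\|^2$ for all $x\in H$; it is tight with frame bound $K$ if one may take $a=b=K$, and Parseval if $a=b=1$. A subset of $(x_i)_{i\in I}$ means $(x_i)_{i\in I_0}$ for some $I_0\subseteq I$. A collection of unit vectors $(x_i)_{i\in I}$ in $H$ is a scalable frame if there exist scalars $(d_i)_{i\in I}$ such that $(d_ix_i)_{i\in I}$ is a Parseval frame for $H$. Universal sequences $(A_n),(B_n)$ with the stated property are known to exist. *)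

(* Defs.v *)
From HB Require Import structures.
From mathcomp Require Import all_boot all_order all_algebra.
From mathcomp Require Import all_classical all_reals all_analysis.
From mathcomp Require Import sesquilinear.
From mathcomp.real_closed Require Import complex.

Set Implicit Arguments.
Unset Strict Implicit.
Unset Printing Implicit Defensive.

Import Order.TTheory GRing.Theory Num.Theory.
Import numFieldNormedType.Exports.

Local Open Scope classical_set_scope.
Local Open Scope ring_scope.

(* Hilbert spaces are taken over one fixed scalar field, which is either the
   field of real numbers or the field of complex numbers. *)
Variant scalar_kind := RealScalars | ComplexScalars.

Definition scalars (R : realType) (k : scalar_kind) : numFieldType :=
  match k with
  | RealScalars => R
  | ComplexScalars => R[i]
  end.

Definition scalar_conj (R : realType) (k : scalar_kind) :
    scalars R k -> scalars R k :=
  match k with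
  | RealScalars => fun z : R => z
  | ComplexScalars => fun z : R[i] => Num.conj z
  end.

(* The norm of R[i] is R[i]-valued; this is the real-valued modulus. *)
Definition scalar_abs (R : realType) (k : scalar_kind) : scalars R k -> R :=
  match k with
  | RealScalars => fun z : R => `|z|
  | ComplexScalars => fun z : R[i] => complex.Re `|z|
  end.

(* Principal square root of an integer. For m < 0 it is imaginary over the
   complex numbers; over the real numbers, where it does not exist, Num.sqrt
   returns 0, so that only the values for m >= 0 occur. *)
Definition scalar_sqrtz (R : realType) (k : scalar_kind) (m : int) :
    scalars R k :=
  match k return scalars R k with
  | RealScalars => Num.sqrt (m%:~R : R)
  | ComplexScalars => sqrtC (m%:~R : R[i])
  end.

(* A finite dimensional Hilbert space is a vectType H with an inner product
   [dot], linear in its first and conjugate-linear in its second argument;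
   completeness is automatic. *)
Section Frames.
Context {R : realType} {k : scalar_kind} {H : vectType (scalars R k)}.
Variable dot : {dot H for @scalar_conj R k}.

Definition hnorm (u : H) : R := Num.sqrt (scalar_abs (dot u u)).

(* (x_i)_{i in D} is a frame with lower bound a and upper bound b; the index
   set may be infinite, hence the unordered sum in the extended reals. *)
Definition frame (I : choiceType) (D : set I) (x : I -> H) (a b : R) : Prop :=
  [/\ 0 < a, 0 < b &
   forall u : H,
     ((a * hnorm u ^+ 2)%:E
        <= \esum_(i in D) (scalar_abs (dot u (x i)) ^+ 2)%:E
        <= (b * hnorm u ^+ 2)%:E)%E].

Definition tight_frame (I : choiceType) (x : I -> H) (C : R) : Prop :=
  frame [set: I] x C C.

Definition parseval_frame (I : choiceType) (x : I -> H) : Prop :=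
  frame [set: I] x 1 1.

Definition scalable_frame (I : choiceType) (x : I -> H) : Prop :=
  (forall i, hnorm (x i) = 1) /\
  exists d : I -> scalars R k, parseval_frame (fun i => d i *: x i).

End Frames.

(* Main.v *)
Require Import Defs.
From mathcomp Require Import all_boot all_order all_algebra.
From mathcomp Require Import all_classical all_reals all_analysis.
From mathcomp Require Import sesquilinear.
From mathcomp Require Import ring lra finmap.
From mathcomp.real_closed Require Import complex.

Set Implicit Arguments.
Unset Strict Implicit.
Unset Printing Implicit Defensive.

Import Order.TTheory GRing.Theory Num.Theory.
Import numFieldNormedType.Exports.

Local Open Scope classical_set_scope.
Local Open Scope ring_scope.

(** Write q_i(u) = |<u, x_i>|^2. Scalability says that the quadratic form
    |u|^2 is a nonnegative combination sum_i w_i q_i, with w_i = |d_i|^2, and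
    the theorem asks for natural numbers m_i such that sum_i (m_i / N^2) q_i
    lies between A_N |u|^2 and B_N |u|^2.

    Suppose first that I is finite. For a large constant C, cut the weight
    C w_i into n_i equal pieces, where n_i is about C N^2 w_i, rounded up.
    Each piece is the squared length of a multiple of x_i of length at most
    1/N, and all pieces together form a tight frame with bound C > 1.
    The selection hypothesis keeps m_i of the n_i pieces of x_i. Replacing
    each piece by the vector x_i / N can only enlarge the frame sum, hence
    preserves the lower bound A_N, and it spoils the upper bound B_N by a
    factor 1 + O(1/C) (approximate_integral_scaling). Evaluating the upper
    bound at u = x_i bounds m_i independently of C; hence only finitely many
    vectors m occur, one of them works for arbitrarily large C, and for this
    one the spurious factor disappears (exact_integral_scaling).

    If I is infinite the weights accumulate at 0, so that rounding up is no
    longer harmless; but finitely many of the vectors suffice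
    (finite_scaling). This is a Caratheodory argument: the q_i live in a
    finite dimensional space, so finitely many q_(f j) span them with real
    coefficients that are controlled by the size of q_i (dominated_spanning).
    A tail of the series sum_i w_i q_i is then a combination of the q_(f j)
    with small, possibly negative, coefficients, which the positive weights
    w_(f j) absorb (finite_cone_of_series). *)

(** * Real part and modulus of a scalar *)

Definition real_scalar (R : realType) (k : scalar_kind) : R -> scalars R k :=
  match k return R -> scalars R k with
  | RealScalars => fun r => r
  | ComplexScalars => fun r => real_complex R r
  end.

Definition scalar_re (R : realType) (k : scalar_kind) : scalars R k -> R :=
  match k return scalars R k -> R with
  | RealScalars => fun z => z
  | ComplexScalars => fun z => complex.Re z
  end.

Section Scalars.
Variables (R : realType) (k : scalar_kind).
Local Notation K := (scalars R k).
Local Notation real_scalar := (@real_scalar R k).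
Implicit Types (y z : K) (r : R).

Lemma scalar_re_sum (T : Type) (s : seq T) (P : pred T) (f : T -> K) :
  scalar_re (\sum_(i <- s | P i) f i) = \sum_(i <- s | P i) scalar_re (f i).
Proof.
rewrite /scalar_re; case: k f => //= f.
apply: (big_morph (@complex.Re R)) => //.
by case=> a b [c d].
Qed.

Lemma scalar_reM (r : R) (z : K) :
  scalar_re (z * real_scalar r) = scalar_re z * r.
Proof.
rewrite /scalar_re /real_scalar; case: k z => //= -[a b] /=.
by rewrite mulr0 subr0.
Qed.

Lemma scalar_re_real (r : R) : scalar_re (real_scalar r) = r.
Proof. by rewrite /scalar_re /real_scalar; case: k. Qed.

Lemma scalar_abs_complexE (z : R[i]) :
  @scalar_abs R ComplexScalars z =
  Num.sqrt (complex.Re z ^+ 2 + complex.Im z ^+ 2).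
Proof. exact: (congr1 (@complex.Re R) (normc_def z)). Qed.

Lemma norm_scalarE (z : K) : `|z| = real_scalar (scalar_abs z).
Proof. by case: k z => // z; rewrite scalar_abs_complexE. Qed.

Lemma real_scalarM r1 r2 :
  real_scalar (r1 * r2) = real_scalar r1 * real_scalar r2.
Proof. by rewrite /real_scalar; case: k => //; exact: rmorphM. Qed.

Lemma scalar_abs_ge0 (z : K) : 0 <= scalar_abs z.
Proof.
case: k z => [|z]; first exact: normr_ge0.
by rewrite scalar_abs_complexE sqrtr_ge0.
Qed.

End Scalars.

Section ScalarsTheory.
Variables (R : realType) (k : scalar_kind).
Local Notation K := (scalars R k).
Local Notation real_scalar := (@real_scalar R k).

Lemma scalar_absM (y z : K) : scalar_abs (y * z) = scalar_abs y * scalar_abs z.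
Proof.
have := normrM y z; rewrite !norm_scalarE /real_scalar.
by case: k y z => // y z; rewrite -rmorphM => /complexI.
Qed.

Lemma scalar_abs_real (r : R) : scalar_abs (real_scalar r) = `|r|.
Proof.
rewrite /real_scalar; case: k => //.
by rewrite scalar_abs_complexE /= expr0n addr0 sqrtr_sqr.
Qed.

Lemma scalar_abs_conj (z : K) : scalar_abs (scalar_conj z) = scalar_abs z.
Proof.
case: k z => // z; congr complex.Re; exact: norm_conjC.
Qed.

Lemma mul_scalar_conj (z : K) :
  z * scalar_conj z = real_scalar (scalar_abs z ^+ 2).
Proof.
case: k z => z; first by rewrite /scalar_abs /= real_normK ?num_real// expr2.
rewrite expr2 real_scalarM -norm_scalarE -expr2.
exact: esym (normCK _).
Qed.

Lemma le_scalar_re_abs (z : K) : `|scalar_re z| <= scalar_abs z.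
Proof.
case: k z => // z; rewrite scalar_abs_complexE /scalar_re.
by rewrite -sqrtr_sqr ler_wsqrtr// lerDl sqr_ge0.
Qed.

Lemma le_real_scalar (r s : R) : (real_scalar r <= real_scalar s) = (r <= s).
Proof. by rewrite /real_scalar; case: k => //; exact: lecR. Qed.

Lemma real_scalarD (r s : R) :
  real_scalar (r + s) = real_scalar r + real_scalar s.
Proof. by rewrite /real_scalar; case: k => //; exact: rmorphD. Qed.

Lemma scalar_abs0 : scalar_abs (0 : K) = 0.
Proof.
case: k; first exact: normr0.
by rewrite scalar_abs_complexE /= !expr0n addr0 sqrtr0.
Qed.

Lemma le_scalar_absD (y z : K) :
  scalar_abs (y + z) <= scalar_abs y + scalar_abs z.
Proof.
have := ler_normD y z.
by rewrite !norm_scalarE -real_scalarD le_real_scalar.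
Qed.

Lemma le_scalar_abs_sum (T : Type) (s : seq T) (P : pred T) (f : T -> K) :
  scalar_abs (\sum_(i <- s | P i) f i) <= \sum_(i <- s | P i) scalar_abs (f i).
Proof.
elim/big_rec2: _ => [|i y1 y2 _ ih]; first by rewrite scalar_abs0.
by rewrite (le_trans (le_scalar_absD _ _))// lerD2l.
Qed.

End ScalarsTheory.

(** This is what makes a natural number of copies of a vector equivalent to a
    single rescaled vector. *)
Lemma scalar_abs_sqrtz_nat (R : realType) (k : scalar_kind) (m : nat) :
  scalar_abs (scalar_sqrtz R k m) ^+ 2 = m%:R.
Proof.
case: k; rewrite /scalar_sqrtz -pmulrn.
  by rewrite /scalar_abs ger0_norm ?sqrtr_ge0// sqr_sqrtr ?ler0n.
rewrite expr2 -(@scalar_absM R ComplexScalars) -expr2 sqrtCK.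
rewrite -(rmorph_nat (real_complex R)).
by rewrite (@scalar_abs_real R ComplexScalars) normr_nat.
Qed.

Lemma scalar_absV_nat (R : realType) (k : scalar_kind) (n : nat) :
  scalar_abs ((n%:R : scalars R k)^-1) = n%:R^-1.
Proof.
have -> : (n%:R : scalars R k)^-1 = real_scalar k n%:R^-1.
  rewrite /real_scalar; case: k => //.
  by rewrite -(rmorph_nat (real_complex R)) -fmorphV.
by rewrite scalar_abs_real ger0_norm// invr_ge0 ler0n.
Qed.

(** * The rank-one quadratic forms of a family of vectors *)

Section Energy.
Variables (R : realType) (k : scalar_kind) (H : vectType (scalars R k)).
Variable dot : {dot H for @scalar_conj R k}.

(** The rank-one form q_x; frame sums are sums of these. *)
Definition energy (x u : H) : R := scalar_abs (dot u x) ^+ 2.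

Lemma energy_ge0 x u : 0 <= energy x u. Proof. exact: sqr_ge0. Qed.

Lemma energyZ c x u : energy (c *: x) u = scalar_abs c ^+ 2 * energy x u.
Proof. by rewrite /energy linearZr_LR /= scalar_absM scalar_abs_conj exprMn. Qed.

Lemma sqr_hnorm u : hnorm dot u ^+ 2 = scalar_abs (dot u u).
Proof. by rewrite sqr_sqrtr// scalar_abs_ge0. Qed.

Lemma hnormZ c u : hnorm dot (c *: u) = scalar_abs c * hnorm dot u.
Proof.
rewrite /hnorm linearZr_LR /= linearZl_LR /= !scalar_absM scalar_abs_conj.
by rewrite mulrA -expr2 sqrtrM ?sqr_ge0// sqrtr_sqr ger0_norm// scalar_abs_ge0.
Qed.

Lemma energy_unit x : hnorm dot x = 1 -> energy x x = 1.
Proof. by move=> h; rewrite /energy -sqr_hnorm h !expr1n. Qed.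

End Energy.

(** * Finitely many of the forms span the others *)

(** A finite subfamily of maximal rank spans: adjoining a vector outside its row
    space would raise the rank, which is at most p. *)
Lemma finite_row_basis (F : fieldType) (I : Type) (D : I -> Prop) (p : nat)
    (G : I -> 'rV[F]_p) :
  exists r (f : 'I_r -> I), (forall j, D (f j)) /\
    forall i, D i -> (G i <= \matrix_j G (f j))%MS.
Proof.
suff grow n : exists r (f : 'I_r -> I), (forall j, D (f j)) /\
    ((n <= \rank (\matrix_j G (f j)))%N \/
     forall i, D i -> (G i <= \matrix_j G (f j))%MS).
  have [r [f [Df [+|?]]]] := grow p.+1; last by exists r, f.
  by rewrite ltnNge rank_leq_col.
elim: n => [|n [r [f [Df [rk_n|]]]]]; last 2 first.
- have [allD|/existsNP[i /not_implyP[Di Gi]]] :=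
    pselect (forall i, D i -> (G i <= \matrix_j G (f j))%MS).
    by exists r, f; split=> //; right.
  exists (1 + r)%N,
    (fun j : 'I_(1 + r) => if fintype.split j is inr j' then f j' else i).
  split; first by move=> j; case: fintype.split.
  left; apply: leq_ltn_trans rk_n _.
  set A := \matrix_j G (f j) in Gi *.
  have -> : \matrix_j G (if fintype.split j is inr j' then f j' else i) =
      col_mx (G i) A.
    apply/row_matrixP => j; rewrite rowK; case: (split_ordP j) => j' ->.
      by rewrite rowKu row_id.
    by rewrite rowKd rowK.
  (* the row space is strictly enlarged, hence so is the rank *)
  have : (A < col_mx (G i) A)%MS.
    rewrite /ltmx col_mx_sub negb_and -addsmxE addsmxSr /=.
    by move/negP: Gi => ->.
  by rewrite ltmxErank => /andP[].
- by exists r, f; split=> //; right.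
- exists 0%N, (fun j : 'I_0 => let: Ordinal _ h := j in False_rect I (notF h)).
  by split=> [[]|]//; left.
Qed.

Section Span.
Variables (R : realType) (k : scalar_kind) (H : vectType (scalars R k)).
Variable dot : {dot H for @scalar_conj R k}.

Lemma dot_conj u v : dot u v = scalar_conj (dot v u).
Proof. by rewrite (hermitian_subproof u v) expr0 mul1r. Qed.

Let dotZl c u v : dot (c *: u) v = c * dot u v.
Proof. exact: linearZl_LR. Qed.

Let dotZr c u v : dot u (c *: v) = scalar_conj c * dot u v.
Proof. exact: linearZr_LR. Qed.

Let e := vbasis {:H}.
Let p := \dim {:H}.

Let gram (x : H) : 'M[scalars R k]_p :=
  \matrix_(a, b) (dot e`_a x * dot x e`_b).

Let cfs (u : H) : 'M[scalars R k]_p :=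
  \matrix_(a, b) (coord e a u * scalar_conj (coord e b u)).

(** The energy depends linearly on the matrix gram x, so linear relations between
    the matrices give relations between the energies, for all u at once. *)
Let gram_energy x u :
  (mxvec (gram x) *m (mxvec (cfs u))^T) 0 0 = real_scalar k (energy dot x u).
Proof.
have -> : energy dot x u = scalar_abs (dot u x) ^+ 2 by [].
rewrite -mul_scalar_conj -dot_conj.
rewrite {2 3}(coord_vbasis (memvf u)) linear_sumlz linear_sumr /=.
rewrite mulr_suml mxE (reindex (uncurry (@mxvec_index p p))) /=; last first.
  exact: curry_mxvec_bij.
under [RHS]eq_bigr do rewrite mulr_sumr.
rewrite pair_big; apply: eq_bigr => -[a b] _ /=.
rewrite mxE !mxvecE !mxE dotZl dotZr -/p -/e; ring.
Qed.

Let energy_sum x := \sum_(a <- e) energy dot x a.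

Let le_gram_energy x q : scalar_abs (mxvec (gram x) 0 q) <= energy_sum x.
Proof.
case/mxvec_indexP: q => a b; rewrite mxvecE mxE scalar_absM.
rewrite (dot_conj x) scalar_abs_conj.
set y := scalar_abs _; set z := scalar_abs _.
have le_energy_sum (c : 'I_p) : energy dot x e`_c <= energy_sum x.
  have ec : e`_c \in (e : seq H) by rewrite mem_nth// size_tuple.
  rewrite /energy_sum (big_rem _ ec) ler_wpDr// sumr_ge0// => v _.
  exact: energy_ge0.
have : y ^+ 2 <= energy_sum x := le_energy_sum a.
have : z ^+ 2 <= energy_sum x := le_energy_sum b.
(* y z <= (y^2 + z^2) / 2 *)
by have := sqr_ge0 (y - z); nra.
Qed.

(** Expand the matrices gram (x i) in a finite subfamily and take real parts of
    the coefficients: the energies are real, so nothing is lost. The bound on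
    the coefficients is linear in the energies of x i, which makes every series
    weighted like a frame sum converge. *)
Lemma dominated_spanning (I : Type) (x : I -> H) (D : I -> Prop) :
  exists r (f : 'I_r -> I) (beta : I -> 'I_r -> R) (M : R) (s : seq H),
  [/\ forall j, D (f j), 0 <= M,
      forall i u, D i ->
        energy dot (x i) u = \sum_j beta i j * energy dot (x (f j)) u &
      forall i j, D i -> `|beta i j| <= M * \sum_(a <- s) energy dot (x i) a].
Proof.
have [r [f [Df spanf]]] := finite_row_basis D (fun i => mxvec (gram (x i))).
set A := \matrix_j _ in spanf.
pose B i := mxvec (gram (x i)) *m pinvmx A.
have BE i : D i -> mxvec (gram (x i)) = B i *m A by move=> /spanf/mulmxKpV.
exists r, f, (fun i j => scalar_re (B i 0 j)).
exists (\sum_j \sum_q scalar_abs (pinvmx A q j)), (vbasis {:H}).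
have abs_ge0 := @scalar_abs_ge0 R k.
split=> //.
- by rewrite sumr_ge0// => j _; rewrite sumr_ge0.
- move=> i u Di; rewrite -(scalar_re_real k (energy dot (x i) u)) -gram_energy.
  rewrite BE// -mulmxA mxE scalar_re_sum; apply: eq_bigr => j _.
  rewrite -scalar_reM; congr (scalar_re (_ * _)).
  rewrite -gram_energy [LHS]mxE [RHS]mxE; apply: eq_bigr => q _.
  by rewrite [A _ _]mxE.
- move=> i j Di; apply: le_trans (le_scalar_re_abs _) _.
  rewrite mxE; apply: le_trans (le_scalar_abs_sum _ _ _) _.
  rewrite mulr_suml (bigD1 j)//= ler_wpDr ?sumr_ge0//.
    move=> j' _; rewrite mulr_ge0 ?sumr_ge0// => *; exact: energy_ge0.
  rewrite mulr_suml; apply: ler_sum => q _; rewrite scalar_absM mulrC.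
  rewrite ler_wpM2l//; exact: le_gram_energy.
Qed.

End Span.

(** * From a convergent series of forms to a finite combination *)

Lemma ge0_esumZl (R : realType) (I : choiceType) (D : set I) (c : R) (a : I -> R) :
  0 <= c -> (forall i, 0 <= a i) ->
  \esum_(i in D) (c * a i)%:E = (c%:E * \esum_(i in D) (a i)%:E)%E.
Proof.
move=> c0 a0; have half (d : R) (b : I -> R) : 0 <= d -> (forall i, 0 <= b i) ->
    (\esum_(i in D) (d * b i)%:E <= d%:E * \esum_(i in D) (b i)%:E)%E.
  move=> d0 b0; apply: ge_ereal_sup => _ [X XD <-].
  under eq_fsbigr do rewrite EFinM.
  rewrite -ge0_mule_fsumr; last by move=> i; rewrite lee_fin.
  by apply: lee_wpmul2l; [rewrite lee_fin|apply: ereal_sup_ubound; exists X].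
apply/eqP; rewrite eq_le half//=.
have [->|cn0] := eqVneq c 0.
  by rewrite mul0e esum_ge0// => i _; rewrite mul0r.
have cgt0 : 0 < c by rewrite lt_neqAle eq_sym cn0.
rewrite -lee_pdivlMl//.
under eq_esum => i _ do rewrite -[a i](mulKf cn0).
by rewrite half ?invr_ge0// => i; rewrite mulr_ge0.
Qed.

Lemma esum_small_tail (R : realType) (I : choiceType) (a : I -> R) (t d : R)
    (Y : set I) :
  (forall i, 0 <= a i) -> \esum_(i in setT) (a i)%:E = t%:E -> 0 < d ->
  finite_set Y ->
  exists2 X : set I, finite_set X /\ Y `<=` X &
    (\esum_(i in ~` X) (a i)%:E <= d%:E)%E.
Proof.
move=> a0 at_ d0 finY.
have : ((t - d)%:E < \esum_(i in setT) (a i)%:E)%E.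
  by rewrite at_ lte_fin; lra.
move=> /ereal_sup_gt[_ [X0 [finX0 _] <-]] ltX0.
have finX : finite_set (X0 `|` Y) by rewrite finite_setU.
exists (X0 `|` Y); first by split=> // i; right.
have a0E i : [set: I] i -> (0 <= (a i)%:E)%E by rewrite lee_fin.
have := esumID (X0 `|` Y) setT _ a0E; rewrite !setTI at_.
rewrite esum_fset//; last by move=> i _; rewrite lee_fin.
have : (\sum_(i \in X0) (a i)%:E <= \sum_(i \in X0 `|` Y) (a i)%:E)%E.
  apply: lee_fsum_nneg_subset => //; first exact/subsetP/subsetUl.
  by move=> i _; rewrite lee_fin.
have : (0 <= \esum_(i in ~` (X0 `|` Y)) (a i)%:E)%E.
  by apply: esum_ge0 => i _; rewrite lee_fin.
move: ltX0; rewrite !fsumEFin//.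
case: (\esum_(i in _) _) => [z| |]//.
rewrite -EFinD !lte_fin !lee_fin => ? ? ? [?]; lra.
Qed.

(** Caratheodory's theorem for series: g = sum_i w_i q_i is already a finite
    nonnegative combination. Choose a finite X containing the spanning indices
    f j, outside which w_i |beta i j| has sum at most d. The tail over the
    complement of X equals sum_j (cp j - cm j) q_(f j), with |cp j - cm j| <= d,
    and d is so small that adding these corrections to the weights w_(f j) > 0
    keeps them nonnegative. *)
Lemma finite_cone_of_series (R : realType) (I U : choiceType)
    (q : I -> U -> R) (w : I -> R) (g : U -> R) (r : nat) (f : 'I_r -> I)
    (beta : I -> 'I_r -> R) (M : R) (s : seq U) :
  (forall i u, 0 <= q i u) -> (forall i, 0 <= w i) ->
  (forall u, \esum_(i in setT) (w i * q i u)%:E = (g u)%:E) ->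
  (forall j, 0 < w (f j)) -> 0 <= M ->
  (forall i u, 0 < w i -> q i u = \sum_j beta i j * q (f j) u) ->
  (forall i j, 0 < w i -> `|beta i j| <= M * \sum_(a <- s) q i a) ->
  exists (F : {fset I}) (v : I -> R), (forall i, 0 <= v i) /\
    forall u, \sum_(i <- F) v i * q i u = g u.
Proof.
move=> q0 w0 wq wf M0 qE betaM.
pose h i := M * \sum_(a <- s) q i a.
have h0 i : 0 <= h i by rewrite mulr_ge0// sumr_ge0.
have wh : \esum_(i in setT) (w i * h i)%:E = (M * \sum_(a <- s) g a)%:E.
  rewrite EFinM -sumEFin; under [in RHS]eq_bigr do rewrite -wq.
  rewrite -esum_sum; last by move=> i a _ _; rewrite lee_fin mulr_ge0.
  under [in RHS]eq_esum do rewrite sumEFin.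
  rewrite -ge0_esumZl//; last by move=> i; rewrite sumr_ge0// => a _; rewrite mulr_ge0.
  by apply: eq_esum => i _; rewrite /h mulrCA mulr_sumr.
(* f may repeat: an index can be hit up to r times, hence the factor r *)
have [d d0 dw] : exists2 d : R, 0 < d & forall j, r%:R * d <= w (f j).
  exists ((\big[Num.min/1]_j w (f j)) / r.+1%:R).
    by rewrite divr_gt0 ?ltr0n//; elim/big_ind: _ => // x y x0 y0; rewrite lt_min x0.
  move=> j; have : \big[Num.min/1]_j w (f j) <= w (f j) by exact: bigmin_le_cond.
  have r1 : 0 < r.+1%:R :> R by rewrite ltr0n.
  rewrite mulrA ler_pdivrMr// -natr1.
  have := wf j; have := ler0n R r; set b := \big[_/_]_j _; nra.
have [X [finX fX] tailX] := @esum_small_tail _ _ _ _ _ (range f)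
  (fun i => mulr_ge0 (w0 i) (h0 i)) wh d0 (finite_image _ finite_finset).
(* An unordered sum is a supremum of finite sums, so it can be split and scaled
   only for nonnegative terms: positive and negative parts are kept apart. *)
pose bp i j := Num.max (beta i j) 0; pose bm i j := Num.max (- beta i j) 0.
have bound b i j : 0 <= b <= `|beta i j| -> 0 <= w i * b <= w i * h i.
  move=> /andP[b0 bb]; rewrite mulr_ge0//=.
  have [wi0|wi0] := eqVneq (w i) 0; first by rewrite wi0 !mul0r.
  rewrite ler_wpM2l// (le_trans bb)// betaM//.
  by rewrite lt_neqAle eq_sym wi0 w0.
have bpb i j : 0 <= w i * bp i j <= w i * h i.
  by apply: (bound _ i j); rewrite /bp le_max lexx orbT ge_max ler_norm normr_ge0.
have bmb i j : 0 <= w i * bm i j <= w i * h i.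
  by apply: (bound _ i j); rewrite /bm le_max lexx orbT ge_max -normrN ler_norm normr_ge0.
have tail (b : I -> R) : (forall i, 0 <= b i <= w i * h i) ->
    exists2 c, 0 <= c <= d & \esum_(i in ~` X) (b i)%:E = c%:E.
  move=> b0; have : (\esum_(i in ~` X) (b i)%:E <= d%:E)%E.
    apply: le_trans tailX; apply: le_esum => i _.
    by rewrite lee_fin; case/andP: (b0 i).
  have : (0 <= \esum_(i in ~` X) (b i)%:E)%E.
    by apply: esum_ge0 => i _; rewrite lee_fin; case/andP: (b0 i).
  case: (\esum_(i in _) _) => [c| |]//; rewrite !lee_fin => c0 cd.
  by exists c => //; rewrite c0.
have [cp cpd cpE] : exists2 c : 'I_r -> R, (forall j, 0 <= c j <= d) &
    forall j, \esum_(i in ~` X) (w i * bp i j)%:E = (c j)%:E.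
  have /choice[c hc] : forall j, exists c, 0 <= c <= d /\
      \esum_(i in ~` X) (w i * bp i j)%:E = c%:E.
    by move=> j; have [c] := tail _ (bpb ^~ j); exists c.
  by exists c => j; case: (hc j).
have [cm cmd cmE] : exists2 c : 'I_r -> R, (forall j, 0 <= c j <= d) &
    forall j, \esum_(i in ~` X) (w i * bm i j)%:E = (c j)%:E.
  have /choice[c hc] : forall j, exists c, 0 <= c <= d /\
      \esum_(i in ~` X) (w i * bm i j)%:E = c%:E.
    by move=> j; have [c] := tail _ (bmb ^~ j); exists c.
  by exists c => j; case: (hc j).
have tailE u : (\esum_(i in ~` X) (w i * q i u)%:E +
    (\sum_j cm j * q (f j) u)%:E = (\sum_j cp j * q (f j) u)%:E)%E.
  have series (c : 'I_r -> R) (b : I -> 'I_r -> R) :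
      (forall i j, 0 <= w i * b i j) ->
      (forall j, \esum_(i in ~` X) (w i * b i j)%:E = (c j)%:E) ->
      (\sum_j c j * q (f j) u)%:E =
      \esum_(i in ~` X) (w i * \sum_j b i j * q (f j) u)%:E.
    move=> b0 cE; rewrite -sumEFin.
    under eq_bigr do rewrite mulrC EFinM -cE -ge0_esumZl//.
    rewrite -esum_sum; last by move=> i j _ _; rewrite lee_fin mulr_ge0.
    apply: eq_esum => i _; rewrite sumEFin; congr EFin.
    by rewrite mulr_sumr; apply: eq_bigr => j _; ring.
  rewrite (series cp bp) ?(series cm bm)//; last 2 first.
  - by move=> i j; case/andP: (bmb i j).
  - by move=> i j; case/andP: (bpb i j).
  rewrite -esumD; last 2 first.
  - by move=> i _; rewrite lee_fin mulr_ge0.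
  - move=> i _; rewrite lee_fin mulr_sumr sumr_ge0// => j _.
    by rewrite mulrA mulr_ge0//; case/andP: (bmb i j).
  apply: eq_esum => i _; rewrite -EFinD -mulrDr; congr EFin.
  have [->|wi0] := eqVneq (w i) 0; first by rewrite !mul0r.
  congr (_ * _); rewrite qE; last by rewrite lt_neqAle eq_sym wi0 w0.
  rewrite -big_split; apply: eq_bigr => j _ /=.
  rewrite -mulrDl /bp /bm; congr (_ * _).
  by rewrite /Num.max; case: ltP => ?; case: ltP => ?; lra.
exists (fset_set X), (fun i => w i + \sum_(j | f j == i) (cp j - cm j)); split.
  move=> i; have [[j /eqP fj]|nof] := pselect (exists j, f j = i); last first.
    rewrite big1 ?addr0// => j /eqP fj; by case: nof; exists j.
  have : - (r%:R * d) <= \sum_(j | f j == i) (cp j - cm j).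
    rewrite mulr_natl -[X in _ *+ X]card_ord -sumr_const -sumrN.
    rewrite (bigID (fun j => f j == i)) /=.
    rewrite -[leRHS]addr0 lerD//; last by apply: sumr_le0 => ? _; lra.
    by apply: ler_sum => j' _; have := cpd j'; have := cmd j'; lra.
  by have := dw j; rewrite (eqP fj); lra.
move=> u; under eq_bigr do rewrite mulrDl mulr_suml.
rewrite big_split /=.
have -> : \sum_(i <- fset_set X) \sum_(j | f j == i) (cp j - cm j) * q i u =
          \sum_j (cp j - cm j) * q (f j) u.
  rewrite (exchange_big_dep xpredT)//=; apply: eq_bigr => j _.
  rewrite (big_rem (f j)) /=; last first.
    by rewrite in_fset_set//; apply/mem_set/fX; exists j.
  rewrite eqxx big_seq_cond big1 ?addr0// => i /andP[+ /eqP fji].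
  by rewrite -fji mem_rem_uniq ?fset_uniq// inE eqxx.
have wq0 i : [set: I] i -> (0 <= (w i * q i u)%:E)%E by rewrite lee_fin mulr_ge0.
have := esumID X setT _ wq0; rewrite !setTI wq.
rewrite esum_fset//; last by move=> i _; rewrite lee_fin mulr_ge0.
rewrite fsbig_finite//= sumEFin.
move: (tailE u); case: (\esum_(i in _) _) => [z| |]//.
rewrite -!EFinD => -[e1] [->].
under [X in _ + X = _]eq_bigr do rewrite mulrBl.
rewrite big_split /= sumrN; lra.
Qed.

(** * Integral scalings of a finite family *)

Lemma esum_finType (R : realType) (J : finType) (D : set J) (a : J -> R) :
  (forall j, 0 <= a j) ->
  \esum_(j in D) (a j)%:E = (\sum_(j | j \in D) a j)%:E.
Proof.
move=> a0; have finD : finite_set D by exact: finite_finset.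
rewrite esum_fset//; last by move=> j _; rewrite lee_fin.
rewrite fsbig_finite//= sumEFin -[in RHS]big_filter; congr EFin.
apply: perm_big; apply: uniq_perm.
- exact: fset_uniq.
- by rewrite filter_uniq// index_enum_uniq.
- by move=> j; rewrite mem_filter mem_index_enum andbT in_fset_set.
Qed.

Section FiniteScaling.
Variables (R : realType) (k : scalar_kind) (H : vectType (scalars R k)).
Variable dot : {dot H for @scalar_conj R k}.
Variables (N : nat) (a b : R).
Hypothesis N0 : (0 < N)%N.
Hypothesis selection : forall (J : choiceType) (y : J -> H) (C : R),
  tight_frame dot y C -> 1 < C ->
  (forall j, hnorm dot (y j) <= N%:R^-1) ->
  exists J0 : set J, frame dot J0 y a b.
Variables (T : finType) (x : T -> H) (w : T -> R).
Hypothesis x1 : forall i, hnorm dot (x i) = 1.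
Hypothesis w0 : forall i, 0 <= w i.
Hypothesis parseval :
  forall u, \sum_i w i * energy dot (x i) u = hnorm dot u ^+ 2.

Let E (m : T -> nat) u := \sum_i (m i)%:R / N%:R ^+ 2 * energy dot (x i) u.

Let NR0 : 0 < N%:R :> R. Proof. by rewrite ltr0n. Qed.

(** The weight C w i is cut into n i pieces of equal length at most 1/N. Every
    selected piece is then lengthened to exactly 1/N, which multiplies its
    contribution to the frame sum by a factor between 1 and 1 + d. *)
Lemma approximate_integral_scaling (d : R) : 0 < d ->
  [/\ 0 < a, 0 < b & exists m : T -> nat, forall u,
    a * hnorm dot u ^+ 2 <= E m u <= (1 + d) * (b * hnorm dot u ^+ 2)].
Proof.
move=> d0.
(* C makes every nonzero target t i at least 1/d, so that rounding it up to an
   integer costs at most a factor 1 + d. *)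
pose C := 2 + \sum_(i | w i != 0) (d * N%:R ^+ 2 * w i)^-1.
have N20 : 0 < N%:R ^+ 2 :> R by rewrite exprn_gt0.
have C2 : 2 <= C.
  by rewrite lerDl sumr_ge0// => i _; rewrite invr_ge0 !mulr_ge0
       ?w0 ?(ltW d0) ?(ltW N20).
pose t i := C * N%:R ^+ 2 * w i.
have t0 i : 0 <= t i by rewrite !mulr_ge0 ?w0 ?(ltW N20)//; lra.
have td i : w i != 0 -> 1 <= d * t i.
  move=> wi; have wi0 : 0 < w i by rewrite lt_neqAle eq_sym wi w0.
  have p0 : 0 < d * N%:R ^+ 2 * w i by rewrite !mulr_gt0.
  have -> : d * t i = C * (d * N%:R ^+ 2 * w i) by rewrite /t; ring.
  rewrite -ler_pdivrMr// mul1r /C (bigD1 i)//=.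
  have : 0 <= \sum_(j | (w j != 0) && (j != i)) (d * N%:R ^+ 2 * w j)^-1.
    by rewrite sumr_ge0// => j _; rewrite invr_ge0 !mulr_ge0
         ?w0 ?(ltW d0) ?(ltW N20).
  by lra.
(* vectors of weight zero get no piece: selecting one would be an error that no
   factor 1 + d can pay for *)
pose n i := if w i == 0 then 0%N else (Num.truncn (t i)).+1.
pose s i := t i / (n i)%:R.
have sn i : (n i)%:R * s i = t i.
  rewrite /s /n; case: eqP => [wi|_]; last by rewrite mulrC divfK// pnatr_eq0.
  by rewrite mul0r /t wi mulr0.
have s01 i : 0 <= s i <= 1.
  rewrite /s divr_ge0//= /n; case: eqP => [wi|_].
    by rewrite invr0 mulr0.
  rewrite ler_pdivrMr ?ltr0n// mul1r.
  by have /andP[_ /ltW] := truncn_itv (t0 i).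
have sd i : (0 < n i)%N -> 1 <= (1 + d) * s i.
  rewrite /s /n; case: eqP => // /eqP wi _.
  rewrite mulrA ler_pdivlMr ?ltr0n// mul1r -natr1.
  by have /andP[+ _] := truncn_itv (t0 i); have := td i wi; lra.
clearbody s; clearbody n.
(* the piece indexed by (i, l) has squared length s i / N^2, so that the n i
   pieces of the i-th vector add up to C w i, by sn *)
pose y (j : {i : T & 'I_(n i)}) :=
  real_scalar k (Num.sqrt (s (tag j)) / N%:R) *: x (tag j).
have abs_y i : scalar_abs (real_scalar k (Num.sqrt (s i) / N%:R)) =
               Num.sqrt (s i) / N%:R.
  by rewrite scalar_abs_real ger0_norm// divr_ge0 ?sqrtr_ge0// ltW.
have energy_y j u : scalar_abs (dot u (y j)) ^+ 2 =
    s (tag j) / N%:R ^+ 2 * energy dot (x (tag j)) u.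
  rewrite -/(energy dot (y j) u) energyZ abs_y expr_div_n sqr_sqrtr//.
  by case/andP: (s01 (tag j)).
have esum_y (D : set {i : T & 'I_(n i)}) u :
    \esum_(j in D) (scalar_abs (dot u (y j)) ^+ 2)%:E =
    (\sum_i #|[pred l : 'I_(n i) | Tagged (fun i => 'I_(n i)) l \in D]|%:R *
       (s i / N%:R ^+ 2 * energy dot (x i) u))%:E.
  rewrite esum_finType; last by move=> j; exact: sqr_ge0.
  congr EFin; under eq_bigr do rewrite energy_y.
  transitivity (\sum_i \sum_(l : 'I_(n i) | Tagged (fun i => 'I_(n i)) l \in D)
      s i / N%:R ^+ 2 * energy dot (x i) u).
    rewrite (sig_big_dep _ (fun i l => Tagged (fun i => 'I_(n i)) l \in D)
      (fun i _ => s i / N%:R ^+ 2 * energy dot (x i) u)) /=.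
    by apply: eq_bigl => -[].
  apply: eq_bigr => i _; rewrite sumr_const mulr_natl.
  by congr (_ *+ _); exact: eq_card.
have tight_y : tight_frame dot y C.
  split; [lra|lra|move=> u].
  have -> : \esum_(j in [set: _]) (scalar_abs (dot u (y j)) ^+ 2)%:E =
      (C * hnorm dot u ^+ 2)%:E; last by rewrite lexx.
  rewrite esum_y -parseval mulr_sumr; congr EFin; apply: eq_bigr => i _.
  rewrite [RHS]mulrA (_ : #|_| = n i); last first.
    by rewrite -[RHS]card_ord; apply: eq_card => l; rewrite !inE /= in_setT.
  have <- : t i / N%:R ^+ 2 = C * w i by rewrite /t; field; rewrite gt_eqF.
  by rewrite -sn; ring.
have small_y j : hnorm dot (y j) <= N%:R^-1.
  rewrite hnormZ x1 mulr1 abs_y ler_piMl ?invr_ge0 ?(ltW NR0)//.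
  rewrite -[leRHS]sqrtr1 ler_wsqrtr//; by case/andP: (s01 (tag j)).
have C1 : 1 < C by lra.
have [D [a0 b0 frameD]] := selection tight_y C1 small_y.
split=> //; pose m i := #|[pred l : 'I_(n i) | Tagged (fun i => 'I_(n i)) l \in D]|.
exists m => u; have := frameD u.
rewrite esum_y !lee_fin => /andP[lo up].
apply/andP; split.
  apply: le_trans lo _; apply: ler_sum => i _.
  rewrite mulrA ler_wpM2r ?energy_ge0// ler_wpM2l// ler_piMl ?invr_ge0 ?(ltW N20)//.
  by case/andP: (s01 i).
apply: le_trans (_ : (1 + d) * _ <= _); last first.
  by rewrite ler_pM2l; [exact: up|lra].
rewrite mulr_sumr; apply: ler_sum => i _.
rewrite -/(m i) [leRHS](_ : _ =
  (m i)%:R * ((1 + d) * s i) / N%:R ^+ 2 * energy dot (x i) u); last by ring.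
rewrite ler_wpM2r ?energy_ge0// ler_wpM2r ?invr_ge0 ?(ltW N20)//.
have [->|mi] := posnP (m i); first by rewrite !mul0r.
rewrite ler_peMr ?ler0n// sd// -[n i]card_ord.
exact: leq_trans mi (max_card _).
Qed.

(** Each error 1/(j+1) is achieved by some m with entries below a common bound M;
    if every such m failed at some j, the largest of these finitely many j
    would have no m at all. So a single m works for all errors. *)
Lemma exact_integral_scaling :
  [/\ 0 < a, 0 < b & exists m : T -> nat, forall u,
    a * hnorm dot u ^+ 2 <= E m u <= b * hnorm dot u ^+ 2].
Proof.
have [a0 b0 _] := approximate_integral_scaling ltr01; split=> //.
pose M := (Num.truncn (2 * b * N%:R ^+ 2)).+1.
pose good (m : {ffun T -> 'I_M}) (j : nat) := forall u,
  a * hnorm dot u ^+ 2 <= E (fun i => m i) u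
    <= (1 + j.+1%:R^-1) * (b * hnorm dot u ^+ 2).
have b_hnorm u : 0 <= b * hnorm dot u ^+ 2 by rewrite mulr_ge0 ?sqr_ge0 ?ltW.
have exgood j : exists m, good m j.
  have [|_ _ [m mP]] := @approximate_integral_scaling j.+1%:R^-1.
    by rewrite invr_gt0 ltr0n.
  (* the upper bound at the unit vector x i controls its multiplicity *)
  have mM i : (m i < M)%N.
    have /andP[_] := mP (x i); rewrite x1 expr1n mulr1 => up.
    have lo : (m i)%:R / N%:R ^+ 2 <= E m (x i).
      rewrite /E (bigD1 i)//= energy_unit// mulr1 lerDl sumr_ge0// => i' _.
      by rewrite mulr_ge0 ?energy_ge0// divr_ge0 ?ler0n// exprn_ge0.
    have j1 : j.+1%:R^-1 <= 1 :> R by rewrite invf_le1 ?ltr0n// ler1n.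
    have : (m i)%:R <= 2 * b * N%:R ^+ 2.
      rewrite -ler_pdivrMr ?exprn_gt0//; apply: le_trans lo (le_trans up _).
      by rewrite ler_wpM2r ?(ltW b0)//; move: j1; set z := _^-1; lra.
    rewrite ltnS truncn_ge_nat// !mulr_ge0 ?(ltW b0)//; exact: exprn_ge0.
  exists [ffun i => Ordinal (mM i)] => u; have := mP u.
  rewrite (_ : E _ u = E m u)//.
  by apply: eq_bigr => i _; rewrite ffunE.
have goodW m j j' : (j <= j')%N -> good m j' -> good m j.
  move=> jj' mg u; have /andP[-> /= up] := mg u; apply: le_trans up _.
  by rewrite ler_wpM2r// lerD2l lef_pV2 ?posrE ?ltr0n// ler_nat.
have [m mgood] : exists m, forall j, good m j.
  apply: contrapT => /forallNP bad.
  have /choice[j jP] : forall m, exists j, ~ good m j.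
    by move=> m; apply/existsNP/bad.
  have [m mg] := exgood (\max_m j m)%N.
  by apply: (jP m); apply: goodW mg; exact: leq_bigmax.
exists (fun i => m i) => u; have /andP[-> /= _] := mgood 0%N u.
apply/ler_addgt0Pr => e e0.
pose j := Num.truncn (b * hnorm dot u ^+ 2 / e).
have /andP[_ /le_trans->//] := mgood j u.
rewrite mulrDl mul1r lerD2l [leLHS]mulrC ler_pdivrMr ?ltr0n//.
rewrite [leRHS]mulrC -ler_pdivrMr// ltW//.
by have /andP[] := truncn_itv (divr_ge0 (b_hnorm u) (ltW e0)).
Qed.
End FiniteScaling.

(** * Arbitrary scalable frames *)

(** A scalable frame of a finite dimensional space stays scalable after discarding
    all but finitely many of its vectors. *)
Lemma finite_scaling (R : realType) (k : scalar_kind)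
    (H : vectType (scalars R k)) (dot : {dot H for @scalar_conj R k})
    (I : choiceType) (x : I -> H) (d : I -> scalars R k) :
  parseval_frame dot (fun i => d i *: x i) ->
  exists (F : {fset I}) (v : I -> R), (forall i, 0 <= v i) /\
    forall u, \sum_(i <- F) v i * energy dot (x i) u = hnorm dot u ^+ 2.
Proof.
move=> [_ _ dP]; pose w i := scalar_abs (d i) ^+ 2.
have [r [f [beta [M [s [wf M0 qE betaM]]]]]] :=
  dominated_spanning dot x (fun i => 0 < w i).
apply: (finite_cone_of_series (w := w) _ _ _ wf M0 qE betaM) => //.
- by move=> i u; exact: energy_ge0.
- by move=> i; exact: sqr_ge0.
move=> u; have := dP u; rewrite mul1r => /le_anti ->.
by apply: eq_esum => i _; rewrite -energyZ.
Qed.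

Theorem theorem2p1 (R : realType) (k : scalar_kind) (A B : nat -> R)
  (hA : A n @[n --> \oo] --> (1 : R))
  (hB : B n @[n --> \oo] --> (1 : R))
  (hAB : forall n : nat, (0 < n)%N ->
     forall (K : vectType (scalars R k)) (dot : {dot K for @scalar_conj R k})
            (J : choiceType) (y : J -> K) (C : R),
       tight_frame dot y C -> 1 < C ->
       (forall j, hnorm dot (y j) <= n%:R^-1) ->
       exists J0 : set J, frame dot J0 y (A n) (B n))
  (N : nat) (hN : (0 < N)%N)
  (H : vectType (scalars R k)) (dot : {dot H for @scalar_conj R k})
  (I : choiceType) (x : I -> H) (hx : scalable_frame dot x) :
  exists c : I -> scalars R k,
    (forall i, exists m : int, c i = scalar_sqrtz R k m / N%:R) /\
    frame dot [set: I] (fun i => c i *: x i) (A N) (B N).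
Proof.
have [x1 [d /finite_scaling[F [v [v0 vP]]]]] := hx.
have [||u|AN BN [m mP]] := @exact_integral_scaling _ _ _ dot N (A N) (B N) hN
  (hAB N hN H dot) F (fun i => x (val i)) (fun i => v (val i)).
- by move=> i; exact: x1.
- by move=> i; exact: v0.
- by rewrite -vP big_seq_fsetE.
pose c i : nat := if insub i is Some i' then m i' else 0%N.
exists (fun i => scalar_sqrtz R k (c i) / N%:R).
split; first by move=> i; exists (c i).
split=> // u; have /andP[lo up] := mP u.
suff -> : \esum_(i in [set: I]) (scalar_abs (dot u
      (scalar_sqrtz R k (c i) / N%:R *: x i)) ^+ 2)%:E =
    (\sum_i (m i)%:R / N%:R ^+ 2 * energy dot (x (val i)) u)%:E.
  by rewrite !lee_fin lo.
have energy_c i : scalar_abs (dot u (scalar_sqrtz R k (c i) / N%:R *: x i)) ^+ 2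
    = (c i)%:R / N%:R ^+ 2 * energy dot (x i) u.
  rewrite -/(energy dot (_ *: _) u) energyZ scalar_absM exprMn.
  by rewrite scalar_abs_sqrtz_nat scalar_absV_nat exprVn.
transitivity (\esum_(i in [set` F])
    ((c i)%:R / N%:R ^+ 2 * energy dot (x i) u)%:E).
  rewrite [RHS]esum_mkcond; apply: eq_esum => i _; rewrite energy_c.
  case: ifPn => // /negP iF; rewrite /c insubN ?mul0r//.
  by apply/negP => iF0; apply: iF; exact/mem_set.
rewrite esum_fset//; last first.
  by move=> i _; rewrite lee_fin mulr_ge0 ?energy_ge0// divr_ge0 ?ler0n// exprn_ge0.
rewrite fsbig_finite// set_fsetK sumEFin big_seq_fsetE; congr EFin.
by apply: eq_bigr => i _; rewrite /c valK.
Qed.
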